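(* Let $v=(v^1,v^2,v^3)\in C_0^\infty(\mathbb{R}^3;\mathbb{R}^3)$ and $p\in C_0^\infty(\mathbb{R}^3)$ satisfy $$\sum_{j=1}^3\frac{\partial (v^iv^j)}{\partial x_j}+\frac{\partial p}{\partial x_i}=0\quad (i=1,2,3),$$ and let $Q_0$ be the quadratic (symmetric rank 2) tensor field $Q_0=(p+|v|^2)\delta_{ij}-2\,v\otimes v$. Then $JQ_0(L)=0$ for every affine plane $L\subset\mathbb{R}^3$.
   Context: $C_0^\infty$ denotes smooth compactly supported functions. For a smooth symmetric rank 2 tensor field $Q$ on $\mathbb{R}^3$ with $|Q(x)|\le C(1+|x|)^{-2-\varepsilon}$ for some $\varepsilon>0$, and an affine plane $L\subset\mathbb{R}^3$, the plane Radon transform of $Q$ is $$JQ(L)=\int_L \operatorname{tr}(Q_{|L})\,d\sigma_L ,$$ where $Q_{|L}$ is the restriction of the quadratic form $Q$ to (the tangent directions of) $L$, the trace is taken with respect to the Euclidean scalar product, and $d\sigma_L$ is the area element on $L$. *)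

(* Defs.v *)
From HB Require Import structures.
From mathcomp Require Import all_boot all_order all_algebra.
From mathcomp Require Import all_classical all_reals all_analysis.
From mathcomp Require Import ring.

Set Implicit Arguments.
Unset Strict Implicit.
Unset Printing Implicit Defensive.

Import Order.TTheory GRing.Theory Num.Theory.
Import numFieldNormedType.Exports.

Local Open Scope classical_set_scope.
Local Open Scope ring_scope.

(* Points and vectors of R^n are row vectors.  The library norm on 'rV[R]_n is
   the sup norm: it is only used for the topology, while Euclidean quantities
   are always written out through coordinates. *)

Definition partial (R : realType) (n : nat) (j : 'I_n) (f : 'rV[R]_n -> R) :
    'rV[R]_n -> R :=
  fun x => 'D_(delta_mx 0 j) f x.

Fixpoint of_class_C (R : realType) (n k : nat) (f : 'rV[R]_n -> R) : Prop :=
  match k with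
  | 0 => continuous f
  | k'.+1 => [/\ continuous f,
      forall (j : 'I_n) (x : 'rV[R]_n), derivable f x (delta_mx 0 j) &
      forall j : 'I_n, of_class_C k' (partial j f)]
  end.

Definition smooth (R : realType) (n : nat) (f : 'rV[R]_n -> R) : Prop :=
  forall k, of_class_C k f.

Definition test_function (R : realType) (n : nat) (f : 'rV[R]_n -> R) : Prop :=
  smooth f /\ compact (closure [set x | f x != 0]).

Definition test_vector_field (R : realType) (n m : nat)
    (v : 'rV[R]_n -> 'rV[R]_m) : Prop :=
  forall i : 'I_m, test_function (fun x => v x 0 i).

Definition plane_param (R : realType) (a : 'rV[R]_3) (D : 'M[R]_(2, 3))
    (st : R * R) : 'rV[R]_3 :=
  a + st.1 *: row 0 D + st.2 *: row 1 D.

Definition affine_plane (R : realType) (L : set 'rV[R]_3) : Prop :=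
  exists a D, row_free D /\ L = range (plane_param a D).

(* The rows of E form an orthonormal basis of the direction of L, so that
   plane_param a E is an isometry from the Euclidean plane onto L. *)
Definition plane_frame (R : realType) (L : set 'rV[R]_3) (a : 'rV[R]_3)
    (E : 'M[R]_(2, 3)) : Prop :=
  E *m E^T = 1%:M /\ L = range (plane_param a E).

Lemma affine_plane_frame (R : realType) (L : set 'rV[R]_3) :
  affine_plane L -> exists a E, plane_frame L a E.
Proof.
move=> [a [D [Dfree ->]]].
pose dot (x y : 'rV[R]_3) := (x *m y^T) 0 0.
have dotC x y : dot x y = dot y x.
  by rewrite /dot !mxE; apply: eq_bigr => i _; rewrite !mxE mulrC.
have dotBl x y z c : dot (x - c *: y) z = dot x z - c * dot y z.
  by rewrite /dot mulmxBl -scalemxAl !mxE.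
have dotZl x y c : dot (c *: x) y = c * dot x y.
  by rewrite /dot -scalemxAl mxE.
have dotZr x y c : dot x (c *: y) = c * dot x y by rewrite dotC dotZl dotC.
have dot_gt0 x : x != 0 -> 0 < dot x x.
  move=> x0; rewrite lt_neqAle; apply/andP; split; last first.
    by rewrite /dot mxE; apply: sumr_ge0 => i _; rewrite mxE -expr2 sqr_ge0.
  apply: contra x0; rewrite eq_sym /dot mxE psumr_eq0; last first.
    by move=> i _; rewrite mxE -expr2 sqr_ge0.
  move=> /allP x0; apply/eqP/rowP => i; rewrite !mxE.
  have := x0 i (mem_index_enum _).
  by rewrite mxE -expr2 sqrf_eq0 => /eqP.
have free2 s t : s *: row 0 D + t *: row 1 D = 0 -> s = 0 /\ t = 0.
  pose z : 'rV[R]_2 := \row_i (if i == 0 then s else t).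
  move=> h; have zD : z *m D = 0.
    rewrite mulmx_sum_row big_ord_recl big_ord1 !mxE /= -h.
    by congr (_ + _ *: row _ _); apply/val_inj.
  have z0 : z = 0 by apply: (row_free_inj Dfree); rewrite zD mul0mx.
  by have /rowP z0' := z0; have := z0' 0; have := z0' 1; rewrite !mxE.
set u := row 0 D in free2 *; set w := row 1 D in free2 *.
have u0 : u != 0.
  apply/eqP => u0; have [] := free2 1 0; last by move/eqP; rewrite oner_eq0.
  by rewrite u0 scaler0 scale0r addr0.
pose m := dot u u; pose c := dot w u / m; pose w' := w - c *: u.
have m0 : 0 < m by exact: dot_gt0.
have w'0 : w' != 0.
  apply/eqP => w'0; have [] := free2 (- c) 1; last by move=> _ /eqP; rewrite oner_eq0.
  by rewrite scale1r scaleNr addrC.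
pose k := dot w' w'; have k0 : 0 < k by exact: dot_gt0.
pose r := Num.sqrt m; pose q := Num.sqrt k.
have r0 : r != 0 by rewrite gt_eqF// sqrtr_gt0.
have q0 : q != 0 by rewrite gt_eqF// sqrtr_gt0.
have rr : r * r = m by rewrite -expr2 sqr_sqrtr// ltW.
have qq : q * q = k by rewrite -expr2 sqr_sqrtr// ltW.
have w'u : dot w' u = 0 by rewrite dotBl -/m /c divfK ?subrr// gt_eqF.
pose E : 'M[R]_(2, 3) := \matrix_i (if i == 0 then r^-1 *: u else q^-1 *: w').
have E0 : row 0 E = r^-1 *: u by rewrite rowK.
have E1 : row 1 E = q^-1 *: w' by rewrite rowK.
exists a, E; split.
  apply/matrixP => i j.
  have -> : (E *m E^T) i j = dot (row i E) (row j E).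
    by rewrite /dot !mxE; apply: eq_bigr => l _; rewrite !mxE.
  have /orP[/eqP-> | /eqP->] : (i == 0) || (i == 1) by case: i => [[|[]]].
    have /orP[/eqP-> | /eqP->] : (j == 0) || (j == 1) by case: j => [[|[]]].
      by rewrite E0 dotZl dotZr mxE -/m -rr /=; field.
    by rewrite E0 E1 dotZl dotZr dotC w'u mxE /= !mulr0.
  have /orP[/eqP-> | /eqP->] : (j == 0) || (j == 1) by case: j => [[|[]]].
    by rewrite E0 E1 dotZl dotZr w'u mxE /= !mulr0.
  by rewrite E1 dotZl dotZr mxE -/k -qq /=; field.
rewrite /plane_param; apply/seteqP; split => _ [[s t] _ <-] /=.
  exists ((s + t * c) * r, t * q) => //=.
  rewrite -/u -/w E0 E1 /w' !scalerA !mulfK//.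
  by apply/rowP => l; rewrite !mxE; ring.
exists (s / r - t / q * c, t / q) => //=; rewrite -/u -/w E0 E1 /w'.
by apply/rowP => l; rewrite !mxE; ring.
Qed.

(* The Gram matrix of the quadratic form Q restricted to the span of the rows
   of E is E *m Q *m E^T; when these are orthonormal, its trace is the Euclidean
   trace of the restriction. *)
Definition restricted_trace (R : realType) (Q : 'M[R]_3) (E : 'M[R]_(2, 3)) : R :=
  \tr (E *m Q *m E^T).

(* JQ(L) = I: L is a plane and, in every orthonormal frame of L, the integral
   of tr(Q|L) converges and is equal to I.  The area element of L is the image of
   the Lebesgue measure of R^2 under the isometry plane_param a E. *)
Definition is_plane_radon (R : realType) (Q : 'rV[R]_3 -> 'M[R]_3)
    (L : set 'rV[R]_3) (I : R) : Prop :=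
  (exists a E, plane_frame L a E) /\
  forall a E, plane_frame L a E ->
    let q := fun st : R * R => restricted_trace (Q (plane_param a E st)) E in
    (lebesgue_measure \x lebesgue_measure)%E.-integrable setT (EFin \o q) /\
    \int[(lebesgue_measure \x lebesgue_measure)%E]_st q st = I.

Definition euler_tensor (R : realType) (v : 'rV[R]_3 -> 'rV[R]_3)
    (p : 'rV[R]_3 -> R) (x : 'rV[R]_3) : 'M[R]_3 :=
  (p x + \sum_(i < 3) v x 0 i ^+ 2)%:M - 2 *: ((v x)^T *m v x).

(* Main.v *)
Require Import Defs.
From HB Require Import structures.
From mathcomp Require Import all_boot all_order all_algebra.
From mathcomp Require Import all_classical all_reals all_analysis.
From mathcomp Require Import measurable_realfun ring lra.

Set Implicit Arguments.
Unset Strict Implicit.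
Unset Printing Implicit Defensive.

Import Order.TTheory GRing.Theory Num.Theory.
Import numFieldNormedType.Exports.

Local Open Scope classical_set_scope.
Local Open Scope ring_scope.

(** Let [w] be a unit normal of the plane [L].  The trace of [Q_0] on [L] is
    [2 (p + |v|^2) - 2 (|v|^2 - (v.w)^2) = 2 (p + (v.w)^2)], that is, twice the normal
    component of the vector field [F = (v.w) v + p w] ([restricted_trace_euler]).  The
    Euler equations say that the tensor [T_ij = v_i v_j + p delta_ij] is divergence free,
    so [F], the contraction of [T] with [w], is a compactly supported divergence-free
    field, and its flux through [L] is zero: by the divergence theorem the flux is the
    same through all planes parallel to [L], and far planes miss the support.

    The flux statement is [solenoidal_flux0], in coordinates [(s, t, u)] adapted to [L]:
    integrate the derivative of the normal component along [u] from outside the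
    support up to [L], exchange the integrals, and observe that on each parallel plane this
    derivative is minus a planar divergence, whose integral vanishes by the one-variable
    fundamental theorem.  Fubini's theorem requires continuous functions on products to be
    measurable for the product sigma-algebras ([measurable_fun_base]).

    To pass to adapted coordinates, the frame of [L] is completed by its cross product to
    an orthonormal frame of the space ([orthonormal_completion]).  Smoothness is given through
    partial derivatives in the standard coordinates; [is_derive_class_C1] provides
    the derivatives in the directions of the frame, and the divergence is the same in both
    frames ([frame_flux_divergence]). *)

(** * Measurability and integrability of continuous functions on products *)

(** A countable family of measurable sets that refines a given choice of
    neighbourhoods.  The neighbourhoods are a bare parameter because the Borel
    structure and the topology of the real line live on two different structured
    types with the same carrier. *)
Definition measurable_base {d : measure_display} {T : measurableType d}
    (nb : T -> set_system T) :=
  exists B : nat -> set T, (forall n, measurable (B n)) /\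
    forall x U, nb x U -> exists n, B n x /\ B n `<=` U.

Lemma measurable_base_real (R : realType) :
  measurable_base (fun x : measurableTypeR R => nbhs (x : R)).
Proof.
pose B (q : rat * rat) : set R := `]ratr q.1, ratr q.2[%classic.
exists (fun n => if unpickle n is Some q then B q else set0); split.
  by move=> n; case: unpickle => [q|//]; exact: measurable_itv.
move=> x U /nbhs_ballP[e /= e0 eU].
have [|q] := @rat_in_itvoo R (x - e) x; first by rewrite ltrBlDr ltrDl.
rewrite in_itv/= => /andP[q1 q2].
have [|r] := @rat_in_itvoo R x (x + e); first by rewrite ltrDl.
rewrite in_itv/= => /andP[r1 r2].
exists (pickle (q, r)); rewrite pickleK; split; first by rewrite /B/= in_itv/= q2.
move=> y; rewrite /B/= in_itv/= => /andP[qy yr]; apply: eU.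
by rewrite /ball/= ltr_distlC (lt_trans q1 qy) (lt_trans yr r2).
Qed.

(** Iterated, this gives rectangles and boxes, which are measurable for the
    product sigma-algebra and form a countable base of the product topology. *)
Lemma measurable_base_prod (d1 d2 : measure_display)
    (T1 : measurableType d1) (T2 : measurableType d2)
    (n1 : T1 -> set_system T1) (n2 : T2 -> set_system T2) :
  measurable_base n1 -> measurable_base n2 ->
  measurable_base (fun z : T1 * T2 => filter_prod (n1 z.1) (n2 z.2)).
Proof.
move=> [B [mB Bn]] [C [mC Cn]].
exists (fun n => if unpickle n is Some q then B q.1 `*` C q.2 else set0); split.
  by move=> n; case: unpickle => [q|//]; apply: measurableX.
move=> [x y] U [[P Q] /= [xP yQ] PQU].
have [i [Bx BP]] := Bn _ _ xP; have [j [Cy CQ]] := Cn _ _ yQ.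
exists (pickle (i, j)); rewrite pickleK; split=> // -[a b] [/= Ba Cb].
by apply: PQU; split; [exact: BP|exact: CQ].
Qed.

(** The preimage of an open interval is the union of the base sets it contains,
    hence a countable union of measurable sets.  This is how continuous functions
    of two and three variables are seen to be measurable for the product
    sigma-algebras. *)
Lemma measurable_fun_base (R : realType) (d : measure_display)
    (T : measurableType d) (nb : T -> set_system T) (f : T -> R) :
  measurable_base nb ->
  (forall x U, nbhs (f x) U -> nb x (f @^-1` U)) ->
  measurable_fun setT f.
Proof.
move=> [B [mB Bn]] cf; apply: (measurability _ (RGenOpens.measurableE R)).
move=> _ [_ [a [b ->] <-]]; rewrite setTI.
set U := (X in f @^-1` X).
have -> : f @^-1` U = \bigcup_(n in [set n | B n `<=` f @^-1` U]) B n.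
  apply/seteqP; split=> [x Ux|x [n /= BU /BU//]].
  have [|n [Bx BU]] := Bn x (f @^-1` U); last by exists n.
  by apply: cf; apply: open_nbhs_nbhs; split=> //; exact: interval_open.
exact: bigcup_measurable.
Qed.

Lemma integrable_bounded_support (R : realType) (d : measure_display)
    (T : measurableType d) (m : {measure set T -> \bar R}) (f : T -> R)
    (K : set T) :
  measurable K -> (m K < +oo)%E -> measurable_fun setT f ->
  [bounded f x | x in K] -> (forall x, ~ K x -> f x = 0) ->
  m.-integrable setT (EFin \o f).
Proof.
move=> mK Koo mf bf f0.
have -> : EFin \o f = (EFin \o f) \_ K.
  by apply/funext => x; rewrite patchE; case: ifPn => // /negP; rewrite inE => /f0/= ->.
apply/(integrable_mkcond _ mK).
by apply: measurable_bounded_integrable => //; exact: measurable_funTS.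
Qed.

Lemma continuous_compact_bounded (R : realType) (S : topologicalType) (f : S -> R)
    (K : set S) : continuous f -> compact K -> [bounded f x | x in K].
Proof.
move=> cf cK.
have /compact_bounded[M [_ mrt]] : compact (f @` K).
  by apply: continuous_compact => //; exact: continuous_subspaceT.
by exists M; split; rewrite ?num_real // => x Mx y Ky; apply: mrt => //; exists y.
Qed.

Lemma continuous_fst_slice (S T U : topologicalType) (f : S * T -> U) (y : T) :
  continuous f -> continuous (fun x => f (x, y)).
Proof.
move=> cf x; apply: (@continuous_comp _ _ _ (fun x : S => (x, y)) f); last exact: cf.
exact: (cvg_pair cvg_id (cvg_cst y)).
Qed.

Lemma continuous_snd_slice (S T U : topologicalType) (f : S * T -> U) (x : S) :
  continuous f -> continuous (fun y => f (x, y)).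
Proof.
move=> cf y; apply: (@continuous_comp _ _ _ (fun y : T => (x, y)) f); last exact: cf.
exact: (cvg_pair (cvg_cst x) cvg_id).
Qed.

Lemma product_measure_lty (d1 d2 : measure_display) (T1 : measurableType d1)
    (T2 : measurableType d2) (R : realType) (m1 : {measure set T1 -> \bar R})
    (m2 : {sigma_finite_measure set T2 -> \bar R}) (A : set T1) (B : set T2) :
  measurable A -> measurable B -> (m1 A < +oo)%E -> (m2 B < +oo)%E ->
  ((m1 \x m2)%E (A `*` B) < +oo)%E.
Proof.
move=> mA mB Aoo Boo; rewrite product_measure1E//.
by rewrite lte_mul_pinfty// ge0_fin_numE.
Qed.

Lemma Fubini_null_slices (d1 d2 : measure_display) (T1 : measurableType d1)
    (T2 : measurableType d2) (R : realType) (m1 : {sigma_finite_measure set T1 -> \bar R})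
    (m2 : {sigma_finite_measure set T2 -> \bar R}) (f : T1 * T2 -> \bar R) :
  (m1 \x m2)%E.-integrable setT f ->
  (forall y, \int[m1]_x f (x, y) = 0)%E ->
  (\int[m1]_x \int[m2]_y f (x, y) = 0)%E.
Proof. by move=> intf f0; rewrite Fubini//; exact: integral0_eq. Qed.

Definition segment (R : realType) (M : R) : set (measurableTypeR R) :=
  `[- M, M]%classic.

Lemma measurable_segment (R : realType) (M : R) : measurable (segment M).
Proof. exact: measurable_itv. Qed.

Lemma segment_lty (R : realType) (M : R) :
  (lebesgue_measure (segment M) < +oo)%E.
Proof. by apply: compact_finite_measure; exact: segment_compact. Qed.

Lemma in_segment (R : realType) (M x : R) : ~~ (M < `|x|) -> segment M x.
Proof. by rewrite -leNgt ler_norml /segment/= in_itv/=. Qed.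

(** The area of the plane, under a name of its own: this is what carries the
    sigma-finite structure with which the product with a third coordinate is
    formed. *)
Definition planar_measure (R : realType) :
    set (measurableTypeR R * measurableTypeR R)%type -> \bar R :=
  (lebesgue_measure \x lebesgue_measure)%E.
Arguments planar_measure : clear implicits.

HB.instance Definition _ R := Measure.on (planar_measure R).

Lemma planar_measure_sigma_finite (R : realType) :
  sigma_finite setT (planar_measure R).
Proof.
exists (fun n => segment n%:R `*` segment n%:R).
  apply/esym; rewrite -subTset => -[x y] _.
  pose k := maxn (Num.bound `|x|) (Num.bound `|y|).
  exists k => //; split; rewrite /segment/= in_itv/= -ler_norml.
    by rewrite (le_trans (ltW (archi_boundP _)))// ler_nat leq_maxl.
  by rewrite (le_trans (ltW (archi_boundP _)))// ler_nat leq_maxr.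
move=> n; split; first by apply: measurableX; exact: measurable_segment.
by apply: product_measure_lty; [exact: measurable_segment..|exact: segment_lty|exact: segment_lty].
Qed.

HB.instance Definition _ R := Measure_isSigmaFinite.Build _ _ _
  (planar_measure R) (@planar_measure_sigma_finite R).

(** * Flux of a compactly supported divergence-free field through a plane *)

Section flux.
Variable R : realType.
Notation mu := (@lebesgue_measure R).
Notation mu2 := (mu \x mu)%E.
Notation mu3 := (planar_measure R \x mu)%E.
Implicit Types (M : R).

Definition outside M (z : R * R * R) : bool :=
  [|| M < `|z.1.1|, M < `|z.1.2| | M < `|z.2|].

Lemma integrable_compact_support2 (f : R * R -> R) M : continuous f ->
  (forall z, (M < `|z.1|) || (M < `|z.2|) -> f z = 0) ->
  mu2.-integrable setT (EFin \o f).
Proof.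
move=> cf f0; apply: (@integrable_bounded_support R _ _ mu2 f (segment M `*` segment M)).
- by apply: measurableX; exact: measurable_segment.
- by apply: product_measure_lty; [exact: measurable_segment..|exact: segment_lty|exact: segment_lty].
- apply: measurable_fun_base cf.
  by apply: measurable_base_prod; exact: measurable_base_real.
- apply: continuous_compact_bounded => //.
  by apply: compact_setX; exact: segment_compact.
- move=> [x y] /= K; apply: f0 => /=; rewrite -[_ || _]negbK negb_or.
  by apply/negP => /andP[/in_segment x0 /in_segment y0]; exact: K.
Qed.

Lemma integrable_compact_support3 (f : R * R * R -> R) M : continuous f ->
  (forall z, outside M z -> f z = 0) ->
  mu3.-integrable setT (EFin \o f).
Proof.
move=> cf f0.
apply: (@integrable_bounded_support R _ _ mu3 f (segment M `*` segment M `*` segment M)).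
- by do 2?apply: measurableX; exact: measurable_segment.
- apply: product_measure_lty; [|exact: measurable_segment| |exact: segment_lty].
    by apply: measurableX; exact: measurable_segment.
  by apply: product_measure_lty; [exact: measurable_segment..|exact: segment_lty|exact: segment_lty].
- apply: measurable_fun_base cf.
  by do 2?apply: measurable_base_prod; exact: measurable_base_real.
- apply: continuous_compact_bounded => //.
  by do 2?apply: compact_setX; exact: segment_compact.
- move=> [[x y] z] /= K; apply: f0; rewrite /outside/= -[[|| _, _ | _]]negbK !negb_or.
  by apply/negP => /and3P[/in_segment x0 /in_segment y0 /in_segment z0]; exact: K.
Qed.

Lemma FTC_is_derive (g g' : R -> R) (a b : R) : a < b ->
  (forall x : R, is_derive x (1 : R) g (g' x)) -> continuous g' ->
  (\int[mu]_(x in `[a, b]) (g' x)%:E = (g b - g a)%:E)%E.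
Proof.
move=> ab dg cg'.
have cg : continuous g.
  by move=> x; apply: differentiable_continuous; apply/derivable1_diffP; case: (dg x).
rewrite (@continuous_FTC2 _ g' g a b) ?EFinB//.
- exact: continuous_subspaceT.
- by split=> [x _| |]; [case: (dg x)|exact/cvg_at_right_filter/cg|exact/cvg_at_left_filter/cg].
- by move=> x _; rewrite derive1E; case: (dg x).
Qed.

Lemma integral_derive0 (g g' : R -> R) (M : R) : 0 <= M ->
  (forall x : R, is_derive x (1 : R) g (g' x)) -> continuous g' ->
  (forall x, M < `|x| -> g x = 0) -> (forall x, M < `|x| -> g' x = 0) ->
  (\int[mu]_x (g' x)%:E = 0)%E.
Proof.
move=> M0 dg cg' g0 g'0.
have h : (\int[mu]_(x in `[(- (M + 1))%R, (M + 1)%R]) (g' x)%:E = 0)%E.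
  rewrite (@FTC_is_derive g)//; last lra.
  by rewrite !g0 ?subrr// ?normrN ger0_norm//; lra.
rewrite -h integral_mkcond [RHS]integral_mkcond !patch_setT; apply: eq_integral => x _.
rewrite patchE; case: ifPn => // /negP; rewrite inE/= in_itv/= -ler_norml => xM.
by rewrite g'0//; move: xM => /negP; rewrite -ltNge; lra.
Qed.

Lemma derive_near0 (g : R -> R) (x d : R) :
  (\near x, g x = 0) -> is_derive x (1 : R) g d -> d = 0.
Proof.
move=> g0 dg; have [_ <-] : is_derive x (1 : R) (cst 0 : R -> R) d.
  by apply: near_eq_is_derive dg; exact: g0.
by rewrite derive_cst.
Qed.

Lemma near_norm_gt M (x : R) : M < `|x| -> \near x, M < `|x|.
Proof.
move=> Mx; have : `|y| @[y --> x] --> `|x| by exact: norm_continuous.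
by move/cvgr_gt; exact.
Qed.

(** [G] is a vector field on coordinates [((s, t), u)] and [D k] the derivative of
    its [k]-th component in the [k]-th coordinate. *)
Section solenoidal.
Variables (M : R) (G D : 'I_3 -> R * R * R -> R).
Hypothesis M0 : 0 <= M.
Hypothesis cG2 : continuous (G 2).
Hypothesis cD : forall k, continuous (D k).
Hypothesis G0 : forall k z, outside M z -> G k z = 0.
Hypothesis dG0 : forall s t u : R,
  is_derive s (1 : R) (fun s => G 0 (s, t, u)) (D 0 (s, t, u)).
Hypothesis dG1 : forall s t u : R,
  is_derive t (1 : R) (fun t => G 1 (s, t, u)) (D 1 (s, t, u)).
Hypothesis dG2 : forall s t u : R,
  is_derive u (1 : R) (fun u => G 2 (s, t, u)) (D 2 (s, t, u)).
Hypothesis div0 : forall z, D 0 z + D 1 z + D 2 z = 0.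

Let D_outside0 z : outside M z -> D 0 z = 0.
Proof.
move: z => [[s t] u]; rewrite /outside/= => sM.
apply: derive_near0 (dG0 s t u).
case/or3P: sM => h.
- near=> x; apply: G0; rewrite /outside/=; apply/or3P; apply: Or31.
  by near: x; exact: near_norm_gt.
- by near=> x; apply: G0; rewrite /outside/= h !orbT.
- by near=> x; apply: G0; rewrite /outside/= h !orbT.
Unshelve. all: by end_near. Qed.

Let D_outside1 z : outside M z -> D 1 z = 0.
Proof.
move: z => [[s t] u]; rewrite /outside/= => sM.
apply: derive_near0 (dG1 s t u).
case/or3P: sM => h.
- by near=> x; apply: G0; rewrite /outside/= h.
- near=> x; apply: G0; rewrite /outside/=; apply/or3P; apply: Or32.
  by near: x; exact: near_norm_gt.
- by near=> x; apply: G0; rewrite /outside/= h !orbT.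
Unshelve. all: by end_near. Qed.

Let integrable_slice k u : (forall z, outside M z -> D k z = 0) ->
  mu2.-integrable setT (fun st => (D k (st, u))%:E).
Proof.
move=> Dk0; apply: (@integrable_compact_support2 (fun st => D k (st, u)) M); first exact: continuous_fst_slice.
by move=> [s t] /= h; apply: Dk0; rewrite /outside/= orbA h.
Qed.

Let integral_slice0 u : (\int[mu2]_st (D 0 (st, u))%:E = 0)%E.
Proof.
have line (t : R) : (\int[mu]_s (D 0 (s, t, u))%:E = 0)%E.
  apply: (@integral_derive0 (fun s : R => G 0 (s, t, u)) (fun s : R => D 0 (s, t, u)) M).
  - exact: M0.
  - exact: (continuous_fst_slice (y := t) (continuous_fst_slice (y := u) (@cD 0))).
  - by move=> s sM; apply: G0; rewrite /outside/= sM.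
  - by move=> s sM; apply: D_outside0; rewrite /outside/= sM.
rewrite -(integral21_prod_meas1 (m1 := mu) (m2 := mu) (f := fun st => (D 0 (st, u))%:E)).
  by apply: integral0_eq => t _; exact: line.
exact: integrable_slice.
Qed.

Let integral_slice1 u : (\int[mu2]_st (D 1 (st, u))%:E = 0)%E.
Proof.
have line (s : R) : (\int[mu]_t (D 1 (s, t, u))%:E = 0)%E.
  apply: (@integral_derive0 (fun t : R => G 1 (s, t, u)) (fun t : R => D 1 (s, t, u)) M).
  - exact: M0.
  - exact: (continuous_snd_slice (x := s) (continuous_fst_slice (y := u) (@cD 1))).
  - by move=> t tM; apply: G0; rewrite /outside/= tM !orbT.
  - by move=> t tM; apply: D_outside1; rewrite /outside/= tM !orbT.
rewrite -(integral12_prod_meas1 (m1 := mu) (m2 := mu) (f := fun st => (D 1 (st, u))%:E)).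
  by apply: integral0_eq => s _; exact: line.
exact: integrable_slice.
Qed.

Let D2E z : D 2 z = - (D 0 z + D 1 z).
Proof. by apply/eqP; rewrite -addr_eq0 addrC div0. Qed.

(* In every plane the derivative across the plane is minus a planar divergence,
   whose integral vanishes. *)
Let integral_slice2 u : (\int[mu2]_st (D 2 (st, u))%:E = 0)%E.
Proof.
have -> : (\int[mu2]_st (D 2 (st, u))%:E =
    \int[mu2]_st (- ((D 0 (st, u))%:E + (D 1 (st, u))%:E)))%E.
  by apply: eq_integral => st _; rewrite D2E.
have [i0 i1] := (@integrable_slice 0 u D_outside0, @integrable_slice 1 u D_outside1).
rewrite integralN; last by exact: integrable_add_def (integrableD measurableT i0 i1).
by rewrite integralD// integral_slice0 integral_slice1 adde0 oppe0.
Qed.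

(** Below the support the field vanishes, so its normal component [G 2] on the plane
    [u = 0] is the integral of [D 2] over [u] between there and [0].  By Fubini its
    total is the integral over those [u] of the integrals of [D 2] over the planes at
    height [u], and [integral_slice2] makes each of them zero. *)
Lemma solenoidal_flux0 :
  mu2.-integrable setT (fun st => (G 2 (st, 0))%:E) /\
  (\int[mu2]_st (G 2 (st, 0))%:E = 0)%E.
Proof.
split.
  apply: (@integrable_compact_support2 (fun st => G 2 (st, 0)) M); first exact: continuous_fst_slice.
  by move=> [s t] /= h; apply: G0; rewrite /outside/= orbA h.
(* The margin 1 puts the lower end strictly outside the support. *)
pose I : set R := `[- (M + 1), 0]%classic.
pose W := (EFin \o D 2) \_ (setT `*` I).
have mI : measurable (I : set (measurableTypeR R)) by exact: measurable_itv.
have iW : mu3.-integrable setT W.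
  have mTI := measurableX (@measurableT _ (measurableTypeR R * measurableTypeR R)%type) mI.
  apply/(integrable_mkcond _ mTI).
  apply: (@integrableS _ _ _ mu3 setT) => //.
  apply: (@integrable_compact_support3 (D 2) M) => // z zM.
  by rewrite D2E D_outside0 ?D_outside1 ?addr0 ?oppr0.
have WE st u : W (st, u) = ((fun u => (D 2 (st, u))%:E) \_ I) u.
  by rewrite /W !patchE in_setX in_setT.
have line (st : R * R) : (\int[mu]_u W (st, u) = (G 2 (st, 0))%:E)%E.
  case: st => s t.
  under eq_integral do rewrite WE.
  rewrite -integral_mkcond.
  rewrite (@FTC_is_derive (fun u : R => G 2 (s, t, u)) (fun u : R => D 2 (s, t, u))).
  - have MM : M < `|M + 1| by rewrite ger0_norm ?addr_ge0// ltrDl.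
    by rewrite [G 2 (s, t, - _)]G0 ?subr0// /outside/= normrN MM !orbT.
  - by rewrite oppr_lt0 ltr_wpDl.
  - exact: (continuous_snd_slice (x := (s, t)) (@cD 2)).
transitivity (\int[mu2]_st \int[mu]_u W (st, u))%E.
  by apply: eq_integral => st _; rewrite line.
have slice0 u : (\int[planar_measure R]_st W (st, u) = 0)%E.
  have [uI|uI] := boolP (u \in I).
    by under eq_integral do rewrite WE patchE uI; exact: integral_slice2.
  by under eq_integral do rewrite WE patchE (negbTE uI); exact: integral0.
exact: (@Fubini_null_slices _ _ _ _ R _ _ _ iW slice0).
Qed.

End solenoidal.
End flux.

(** * Directional derivatives of functions with continuous partial derivatives *)

Section directional.
Variables (R : realType) (V : normedModType R).
Implicit Types (f : V -> R) (x y u w : V).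

Lemma is_derive_line f y u (t d : R) :
  is_derive (t *: u + y) u f d ->
  is_derive t (1 : R) (fun s : R => f (s *: u + y)) d.
Proof.
have E : (fun h : R => h^-1 *: (((fun s : R => f (s *: u + y)) \o shift t) (h *: (1 : R))
             - f (t *: u + y))) =
         (fun h : R => h^-1 *: ((f \o shift (t *: u + y)) (h *: u) - f (t *: u + y))).
  by apply/funext => h /=; rewrite [h *: (1 : R)]mulr1 scalerDl addrA.
by move=> [df <-]; split; rewrite /derivable /derive E.
Qed.

Lemma mean_value_line f y u (h : R) : (forall x, derivable f x u) ->
  exists2 t : R, `|t| <= `|h| & f (h *: u + y) - f y = h * 'D_u f (t *: u + y).
Proof.
move=> df; pose g (s : R) := f (s *: u + y); pose g' (s : R) := 'D_u f (s *: u + y).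
have dg (s : R) : is_derive s (1 : R) g (g' s).
  by apply: is_derive_line; exact: derivableP.
have cg : continuous g.
  by move=> s; apply: differentiable_continuous; apply/derivable1_diffP; case: (dg s).
have g0 : g 0 = f y by rewrite /g scale0r add0r.
have [h0|h0] := leP 0 h.
  have [t th] := MVT_segment h0 (fun s _ => dg s) (continuous_subspaceT cg).
  rewrite g0 subr0 => e; exists t; last by rewrite -/(g h) e mulrC.
  by move: th; rewrite in_itv/= => /andP[t0 th]; rewrite !ger0_norm.
have [t th] := MVT_segment (ltW h0) (fun s _ => dg s) (continuous_subspaceT cg).
rewrite g0 sub0r => e; exists t; last by rewrite -/(g h) -[LHS]opprB e mulrN opprK mulrC.
move: th; rewrite in_itv/= => /andP[th t0].
by rewrite (ler0_norm t0) (ltr0_norm h0) lerN2.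
Qed.

(** Adding a direction in which the derivative is continuous: the increment of [f]
    along [h *: (w + c *: u)] splits at [h *: w], and the mean value theorem turns the
    part along [u] into [h * c] times a derivative at a point that tends to [x]. *)
Lemma is_derive_addv f x w u (a c : R) :
  (forall y, derivable f y u) -> {for x, continuous (fun y => 'D_u f y)} ->
  is_derive x w f a -> is_derive x (w + c *: u) f (a + c * 'D_u f x).
Proof.
move=> df cf [dw aE].
suff cv : (fun h : R => h^-1 *: ((f \o shift x) (h *: (w + c *: u)) - f x)) h
    @[h --> 0^'] --> a + c * 'D_u f x.
  by split; [apply/cvg_ex; exists (a + c * 'D_u f x)|exact: cvg_lim].
pose q1 (h : R) := h^-1 *: ((f \o shift x) (h *: w) - f x).
pose q2 (h : R) := h^-1 * (f ((h * c) *: u + (h *: w + x)) - f (h *: w + x)).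
have -> : (fun h : R => h^-1 *: ((f \o shift x) (h *: (w + c *: u)) - f x)) =
    (fun h => q1 h + q2 h).
  apply/funext => h; rewrite /q1 /q2 /= [h^-1 *: _]/(h^-1 * _) [h^-1 *: (f _ - _)]/(h^-1 * _).
  rewrite -mulrDr (addrC (_ - f x)) subrKA; congr (_ * (f _ - _)).
  by rewrite scalerDr scalerA addrCA addrA.
apply: cvgD; first by rewrite -aE.
apply/cvgrPdist_le => /= e e0.
(* The 1 guards against c = 0. *)
have e'0 : 0 < e / (`|c| + 1) by rewrite divr_gt0// ltr_wpDl.
move/cvgrPdist_le: cf => /(_ _ e'0)/nbhs_ballP[r /= r0 rP].
(* All intermediate points lie within `|h| * B of x. *)
pose B := `|w| + `|c| * `|u| + 1.
have B0 : 0 < B by rewrite ltr_wpDl// addr_ge0// mulr_ge0.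
near=> h.
have h0 : h != 0 by near: h; exact: nbhs_dnbhs_neq.
have hB : `|h| * B < r.
  by rewrite -ltr_pdivlMr//; near: h; apply: dnbhs0_lt; rewrite divr_gt0.
have [t th] := mean_value_line (h *: w + x) (h * c) df; rewrite /q2 => ->.
rewrite !mulrA mulVf// mul1r -mulrBr normrM.
apply: (@le_trans _ _ (`|c| * (e / (`|c| + 1)))); last first.
  have c1 : 0 < `|c| + 1 by rewrite ltr_wpDl.
  by rewrite mulrCA ler_piMr ?(ltW e0)// ler_pdivrMr// mul1r lerDl.
apply: ler_wpM2l => //; apply: rP.
rewrite -ball_normE /ball_/= addrA opprD addrA addrAC subrr sub0r normrN.
apply: le_lt_trans hB; apply: (le_trans (ler_normD _ _)).
rewrite !normrZ /B mulrDr mulrDr mulr1 -addrA addrC lerD//.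
apply: (@le_trans _ _ (`|h * c| * `|u|)); first exact: ler_wpM2r.
by rewrite normrM mulrA lerDl.
Unshelve. all: by end_near. Qed.

End directional.

(** Continuous partial derivatives give a derivative in every direction, linear in
    the direction: the coordinate directions are added one at a time. *)
Lemma is_derive_class_C1 (R : realType) (n : nat) (f : 'rV[R]_n -> R)
    (x w : 'rV[R]_n) :
  of_class_C 1 f -> is_derive x w f (\sum_j w 0 j * partial j f x).
Proof.
move=> [cf df cdf].
suff H (s : seq 'I_n) : is_derive x (\sum_(j <- s) w 0 j *: delta_mx 0 j) f
    (\sum_(j <- s) w 0 j * partial j f x).
  by rewrite [X in is_derive _ X](row_sum_delta w); exact: H.
elim: s => [|j s IH]; first by rewrite !big_nil; exact: is_derive0.
rewrite !big_cons addrC [X in is_derive _ _ _ X]addrC.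
by apply: is_derive_addv => //; exact: cdf.
Qed.

Lemma sum3E (R : nmodType) (F : 'I_3 -> R) : \sum_i F i = F 0 + F 1 + F 2.
Proof.
rewrite 3!big_ord_recl big_ord0 addr0 addrA.
by congr (_ + F _ + F _); apply/val_inj.
Qed.

Lemma continuous_mulf (R : realType) (S : topologicalType) (f g : S -> R) :
  continuous f -> continuous g -> continuous (fun x => f x * g x).
Proof. by move=> cf cg x; apply: cvgM; [exact: cf|exact: cg]. Qed.

Lemma continuous_addf (R : realType) (S : topologicalType) (f g : S -> R) :
  continuous f -> continuous g -> continuous (fun x => f x + g x).
Proof. by move=> cf cg x; apply: cvgD; [exact: cf|exact: cg]. Qed.

Section class_C1.
Variables (R : realType) (n : nat).
Implicit Types f g : 'rV[R]_n -> R.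

Lemma class_C1M f g : of_class_C 1 f -> of_class_C 1 g ->
  of_class_C 1 (fun x => f x * g x).
Proof.
move=> [cf df cdf] [cg dg cdg]; split.
- exact: continuous_mulf.
- by move=> j x; apply: derivableM; [exact: df|exact: dg].
- move=> j; have -> : partial j (fun x => f x * g x) =
      (fun x => f x * partial j g x + g x * partial j f x).
    by apply/funext => x; rewrite /partial -[LHS]/('D__ (f * g) x) deriveM.
  apply: continuous_addf; exact: continuous_mulf.
Qed.

Lemma class_C1D f g : of_class_C 1 f -> of_class_C 1 g ->
  of_class_C 1 (fun x => f x + g x).
Proof.
move=> [cf df cdf] [cg dg cdg]; split.
- exact: continuous_addf.
- by move=> j x; apply: derivableD; [exact: df|exact: dg].
- move=> j; have -> : partial j (fun x => f x + g x) =
      (fun x => partial j f x + partial j g x).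
    by apply/funext => x; rewrite /partial -[LHS]/('D__ (f + g) x) deriveD.
  by apply: continuous_addf; [exact: cdf|exact: cdg].
Qed.

Lemma class_C1_cst (c : R) :
  of_class_C 1 (fun _ : 'rV[R]_n => c).
Proof.
split; [exact: cst_continuous|by move=> j x; exact: derivable_cst|].
move=> j; rewrite (_ : partial _ _ = cst 0); first exact: cst_continuous.
by apply/funext => x; rewrite /partial -[LHS]/('D__ (cst c) x) derive_cst.
Qed.

Lemma test_function_C1 f :
  test_function f -> of_class_C 1 f.
Proof. by move=> [/(_ 1%N)]. Qed.

End class_C1.

Section combinations.
Variable R : realType.

Lemma is_derive_sumf (V : normedModType R) (I : Type) (s : seq I)
    (h : I -> V -> R) (dh : I -> R) (x v : V) :
  (forall i, is_derive x v (h i) (dh i)) ->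
  is_derive x v (fun y => \sum_(i <- s) h i y) (\sum_(i <- s) dh i).
Proof.
move=> H; elim: s => [|i s IH].
  rewrite big_nil (_ : (fun _ => _) = cst 0); first exact: is_derive_cst.
  by apply/funext => y; rewrite big_nil.
rewrite big_cons (_ : (fun _ => _) = h i + (fun y => \sum_(i <- s) h i y)).
  exact: is_deriveD.
by apply/funext => y; rewrite big_cons.
Qed.

Lemma is_derive_scalef (V : normedModType R) (h : V -> R) (c d : R) (x v : V) :
  is_derive x v h d -> is_derive x v (fun y => c * h y) (c * d).
Proof. by move=> H; exact: is_deriveZ. Qed.

Lemma continuous_sumf (S : topologicalType) (I : Type) (s : seq I) (h : I -> S -> R) :
  (forall i, continuous (h i)) -> continuous (fun y => \sum_(i <- s) h i y).
Proof.
move=> H; elim: s => [|i s IH].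
  rewrite (_ : (fun _ => _) = cst 0); first by move=> x; exact: cvg_cst.
  by apply/funext => y; rewrite big_nil.
rewrite (_ : (fun _ => _) = (fun y => h i y + \sum_(i <- s) h i y)).
  exact: continuous_addf.
by apply/funext => y; rewrite big_cons.
Qed.

Lemma continuous_scalef (S : topologicalType) (h : S -> R) (c : R) :
  continuous h -> continuous (fun y => c * h y).
Proof. by move=> H x; apply: cvgM; [exact: cvg_cst|exact: H]. Qed.

End combinations.

(** * Orthonormal frames *)

Section frame.
Variables (R : realType).

(** The third row is the cross product of the first two; it is a unit vector by
    Lagrange's identity. *)
Lemma orthonormal_completion (E : 'M[R]_(2, 3)) : E *m E^T = 1%:M ->
  exists P : 'M[R]_3, [/\ P *m P^T = 1%:M, row 0 P = row 0 E & row 1 P = row 1 E].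
Proof.
move=> hE.
pose c (i j : 'I_3) : R := E 0 i * E 1 j - E 0 j * E 1 i.
pose w : 'rV[R]_3 := \row_k (if k == 0 then c 1 2 else if k == 1 then c 2 0 else c 0 1).
exists (\matrix_(k < 3) (if k == 0 then row 0 E else if k == 1 then row 1 E else w)).
split; last 2 first.
- by rewrite rowK.
- by rewrite rowK.
have e i j : E i 0 * E j 0 + E i 1 * E j 1 + E i 2 * E j 2 = (i == j)%:R.
  by have /matrixP/(_ i j) := hE; rewrite !mxE sum3E !mxE.
have := (e 0 0, e 0 1, e 1 1); rewrite /= => -[[e00 e01] e11].
have w1 : c 1 2 * c 1 2 + c 2 0 * c 2 0 + c 0 1 * c 0 1 = 1.
  (* Lagrange's identity. *)
  transitivity ((E 0 0 * E 0 0 + E 0 1 * E 0 1 + E 0 2 * E 0 2) *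
      (E 1 0 * E 1 0 + E 1 1 * E 1 1 + E 1 2 * E 1 2) -
      (E 0 0 * E 1 0 + E 0 1 * E 1 1 + E 0 2 * E 1 2) ^+ 2).
    by rewrite /c; ring.
  by rewrite e00 e01 e11; ring.
have ord3 (k : 'I_3) : [\/ k = 0, k = 1 | k = 2].
  by case: k => [[|[|[|//]]] ?]; [apply: Or31|apply: Or32|apply: Or33]; exact/val_inj.
apply/matrixP => k l; rewrite !mxE sum3E.
case: (ord3 k) => ->; case: (ord3 l) => ->; rewrite !mxE /= ?mxE /=.
all: try by rewrite e.
all: try by rewrite /c; ring.
by rewrite w1.
Qed.

(** With [w] the unit normal, row 2 of [P], both sides are twice [(v.w)^2 + p]: the two
    tangential squares removed from [|v|^2] by the trace leave the normal one. *)
Lemma restricted_trace_euler (v : 'rV[R]_3) (p : R) (P : 'M[R]_3) (E : 'M[R]_(2, 3)) :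
  P *m P^T = 1%:M -> row 0 P = row 0 E -> row 1 P = row 1 E ->
  restricted_trace ((p + \sum_(i < 3) v 0 i ^+ 2)%:M - 2 *: (v^T *m v)) E =
  2 * \sum_i \sum_j P 2 i * P 2 j * (v 0 i * v 0 j + p * (i == j)%:R).
Proof.
move=> hP r0 r1.
have E0 j : E 0 j = P 0 j by have /rowP/(_ j) := r0; rewrite !mxE.
have E1 j : E 1 j = P 1 j by have /rowP/(_ j) := r1; rewrite !mxE.
have e i j : P i 0 * P j 0 + P i 1 * P j 1 + P i 2 * P j 2 = (i == j)%:R.
  by have /matrixP/(_ i j) := hP; rewrite !mxE sum3E !mxE.
have hP' : P^T *m P = 1%:M by exact: mulmx1C.
have f i j : P 0 i * P 0 j + P 1 i * P 1 j + P 2 i * P 2 j = (i == j)%:R.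
  by have /matrixP/(_ i j) := hP'; rewrite !mxE sum3E !mxE.
(* Coordinates of v in the frame; by Parseval they have the same sum of squares. *)
pose q k := P k 0 * v 0 0 + P k 1 * v 0 1 + P k 2 * v 0 2.
have qq : v 0 0 ^+ 2 + v 0 1 ^+ 2 + v 0 2 ^+ 2 = q 0 ^+ 2 + q 1 ^+ 2 + q 2 ^+ 2.
  transitivity (v 0 0 ^+ 2 * (P 0 0 * P 0 0 + P 1 0 * P 1 0 + P 2 0 * P 2 0)
    + v 0 1 ^+ 2 * (P 0 1 * P 0 1 + P 1 1 * P 1 1 + P 2 1 * P 2 1)
    + v 0 2 ^+ 2 * (P 0 2 * P 0 2 + P 1 2 * P 1 2 + P 2 2 * P 2 2)
    + 2 * v 0 0 * v 0 1 * (P 0 0 * P 0 1 + P 1 0 * P 1 1 + P 2 0 * P 2 1)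
    + 2 * v 0 0 * v 0 2 * (P 0 0 * P 0 2 + P 1 0 * P 1 2 + P 2 0 * P 2 2)
    + 2 * v 0 1 * v 0 2 * (P 0 1 * P 0 2 + P 1 1 * P 1 2 + P 2 1 * P 2 2)).
    by rewrite !f /=; ring.
  by rewrite /q; ring.
rewrite /restricted_trace /mxtrace big_ord_recl big_ord1.
rewrite (_ : lift ord0 ord0 = 1 :> 'I_2); last exact/val_inj.
rewrite !(mxE, sum3E, big_ord1) /= ?E0 ?E1 !mulr1n !mulr0n.
set S := v 0 0 ^+ 2 + _ + _ in qq *.
transitivity ((p + S) * ((P 0 0 * P 0 0 + P 0 1 * P 0 1 + P 0 2 * P 0 2)
   + (P 1 0 * P 1 0 + P 1 1 * P 1 1 + P 1 2 * P 1 2)) - 2 * (q 0 ^+ 2 + q 1 ^+ 2)).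
  by rewrite /q; ring.
transitivity (2 * (q 2 ^+ 2 + p * (P 2 0 * P 2 0 + P 2 1 * P 2 1 + P 2 2 * P 2 2))).
  by rewrite !e qq /=; ring.
by rewrite /q; ring.
Qed.

End frame.

(** * Contraction of a divergence-free tensor with a normal vector *)

Lemma continuous_fst (S T : topologicalType) : continuous (@fst S T).
Proof. by move=> x; exact: cvg_fst. Qed.

Lemma continuous_snd (S T : topologicalType) : continuous (@snd S T).
Proof. by move=> x; exact: cvg_snd. Qed.

Definition frame_point (R : realType) (a : 'rV[R]_3) (P : 'M[R]_3) (z : R * R * R) :
    'rV[R]_3 :=
  a + z.1.1 *: row 0 P + z.1.2 *: row 1 P + z.2 *: row 2 P.

Lemma frame_point_continuous (R : realType) (a : 'rV[R]_3) (P : 'M[R]_3) :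
  continuous (frame_point a P).
Proof.
have c1 : continuous (fun z : R * R * R => z.1.1).
  by move=> z; apply: (@continuous_comp _ _ _ fst fst); exact: continuous_fst.
have c2 : continuous (fun z : R * R * R => z.1.2).
  move=> z; apply: (@continuous_comp _ _ _ fst snd); [exact: continuous_fst|exact: continuous_snd].
have c3 : continuous (fun z : R * R * R => z.2) by exact: continuous_snd.
move=> z; rewrite /frame_point.
apply: cvgD; [apply: cvgD; [apply: cvgD|]|].
- exact: cvg_cst.
- by apply: cvgZr_tmp; exact: c1.
- by apply: cvgZr_tmp; exact: c2.
- by apply: cvgZr_tmp; exact: c3.
Qed.

(** [T] is a divergence-free tensor field and the rows of [P] an orthonormal frame.
    Contracting [T] with the last row of [P] gives a divergence-free vector field, and
    [frame_flux k] is its component along row [k]. *)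
Section radon.
Variables (R : realType) (T : 'I_3 -> 'I_3 -> 'rV[R]_3 -> R).
Hypothesis TC1 : forall i j, of_class_C 1 (T i j).
Hypothesis divT : forall i x, \sum_j partial j (T i j) x = 0.
Hypothesis suppT : exists2 K, compact K & forall i j x, ~ K x -> T i j x = 0.
Variables (a : 'rV[R]_3) (P : 'M[R]_3).
Hypothesis PP : P *m P^T = 1%:M.

Definition frame_flux (k : 'I_3) (x : 'rV[R]_3) : R :=
  \sum_i \sum_j (P 2 i * P k j) * T i j x.

Definition frame_flux_derive (k : 'I_3) (x : 'rV[R]_3) : R :=
  \sum_i \sum_j (P 2 i * P k j) * \sum_l row k P 0 l * partial l (T i j) x.

Lemma frame_flux_continuous k : continuous (frame_flux k).
Proof.
apply: continuous_sumf => i; apply: continuous_sumf => j.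
by apply: continuous_scalef; case: (TC1 i j).
Qed.

Lemma frame_flux_derive_continuous k : continuous (frame_flux_derive k).
Proof.
apply: continuous_sumf => i; apply: continuous_sumf => j.
apply: continuous_scalef; apply: continuous_sumf => l; apply: continuous_scalef.
by case: (TC1 i j) => _ _; exact.
Qed.

Lemma is_derive_frame_flux k x :
  is_derive x (row k P) (frame_flux k) (frame_flux_derive k x).
Proof.
apply: is_derive_sumf => i; apply: is_derive_sumf => j.
by apply: is_derive_scalef; exact: is_derive_class_C1.
Qed.

(** The divergence does not depend on the orthonormal frame: summing over the frame
    leaves [P^T *m P = 1] between the indices [j] and [l]. *)
Lemma frame_flux_divergence x :
  frame_flux_derive 0 x + frame_flux_derive 1 x + frame_flux_derive 2 x = 0.
Proof.
have f j l : \sum_k P k j * P k l = (j == l)%:R.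
  by have /matrixP/(_ j l) := mulmx1C PP; rewrite !mxE => <-; apply: eq_bigr => k _; rewrite !mxE.
rewrite -(sum3E (frame_flux_derive ^~ x)) /frame_flux_derive exchange_big big1 //= => i _.
rewrite exchange_big /=.
transitivity (P 2 i * \sum_j partial j (T i j) x); last by rewrite divT mulr0.
rewrite mulr_sumr; apply: eq_bigr => j _.
transitivity (P 2 i * \sum_l (\sum_k P k j * P k l) * partial l (T i j) x).
  rewrite mulr_sumr; under [RHS]eq_bigr do rewrite mulr_suml mulr_sumr.
  rewrite [RHS]exchange_big /=; apply: eq_bigr => k _.
  by rewrite mulr_sumr; apply: eq_bigr => l _; rewrite mxE !mulrA.
congr (_ * _); rewrite (bigD1 j)//= f eqxx mul1r big1 ?addr0// => l lj.
by rewrite f eq_sym (negbTE lj) mul0r.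
Qed.

(** The frame coordinates are continuous, hence bounded on the compact support. *)
Lemma frame_flux_support : exists2 M, 0 <= M & forall k z, outside M z ->
  frame_flux k (frame_point a P z) = 0.
Proof.
have [K cK K0] := suppT.
pose c (k : 'I_3) (x : 'rV[R]_3) := \sum_j P k j * (x 0 j - a 0 j).
have cc k : continuous (c k).
  apply: continuous_sumf => j; apply: continuous_scalef.
  apply: continuous_addf; [exact: coord_continuous|exact: cst_continuous].
have bnd k : exists2 M, 0 <= M & forall x, K x -> `|c k x| <= M.
  have [M [Mr HM]] := continuous_compact_bounded (cc k) cK.
  exists (`|M| + 1); first by rewrite addr_ge0.
  by move=> x Kx; apply: (HM (`|M| + 1)) => //; rewrite ltr_pwDr// ler_norm.
have [M0 p0 b0] := bnd 0; have [M1 p1 b1] := bnd 1; have [M2 p2 b2] := bnd 2.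
exists (M0 + M1 + M2); first by rewrite !addr_ge0.
move=> k [[s t] u] /= oz.
apply: big1 => i _; apply: big1 => j _; rewrite K0 ?mulr0// => KY.
have e (m k' : 'I_3) : \sum_l P m l * P k' l = (m == k')%:R.
  by have /matrixP/(_ m k') := PP; rewrite !mxE => <-; apply: eq_bigr => l _; rewrite !mxE.
have cE m : c m (frame_point a P (s, t, u)) =
    s * (m == 0)%:R + t * (m == 1)%:R + u * (m == 2)%:R.
  rewrite -!e !mulr_sumr -!big_split /=; apply: eq_bigr => l _.
  by rewrite /frame_point !mxE /=; ring.
have := (b0 _ KY, b1 _ KY, b2 _ KY); rewrite !cE /= !(mulr0, mulr1, addr0, add0r).
move=> [[s0 t1] u2]; case/or3P: oz => /=; apply/negP; rewrite -leNgt; lra.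
Qed.

Lemma frame_flux_plane0 :
  (planar_measure R).-integrable setT
    (fun st => (frame_flux 2 (frame_point a P (st, 0)))%:E) /\
  (\int[planar_measure R]_st (frame_flux 2 (frame_point a P (st, 0)))%:E = 0)%E.
Proof.
have [M M0 G0] := frame_flux_support.
have cY (f : 'rV[R]_3 -> R) : continuous f -> continuous (fun z => f (frame_point a P z)).
  by move=> cf z; apply: continuous_comp; [exact: frame_point_continuous|exact: cf].
apply: (@solenoidal_flux0 R M (fun k z => frame_flux k (frame_point a P z))
  (fun k z => frame_flux_derive k (frame_point a P z))) => //.
- by apply: cY; exact: frame_flux_continuous.
- by move=> k; apply: cY; exact: frame_flux_derive_continuous.
- move=> s t u; pose b := a + t *: row 1 P + u *: row 2 P.
  have E s' : frame_point a P (s', t, u) = s' *: row 0 P + b.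
    by rewrite /frame_point /b /= (addrC a) -!addrA.
  rewrite E; under eq_fun do rewrite E.
  by apply: is_derive_line; exact: is_derive_frame_flux.
- move=> s t u; pose b := a + s *: row 0 P + u *: row 2 P.
  have E t' : frame_point a P (s, t', u) = t' *: row 1 P + b.
    by rewrite /frame_point /b /= (addrC (a + _)) -!addrA.
  rewrite E; under eq_fun do rewrite E.
  by apply: is_derive_line; exact: is_derive_frame_flux.
- move=> s t u; pose b := a + s *: row 0 P + t *: row 1 P.
  have E u' : frame_point a P (s, t, u') = u' *: row 2 P + b.
    by rewrite /frame_point /b /= addrC.
  rewrite E; under eq_fun do rewrite E.
  by apply: is_derive_line; exact: is_derive_frame_flux.
- by move=> z; exact: frame_flux_divergence.
Qed.

End radon.

(** * The momentum flux tensor of the Euler equations *)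

Definition momentum_flux (R : realType) (v : 'rV[R]_3 -> 'rV[R]_3)
    (p : 'rV[R]_3 -> R) (i j : 'I_3) (x : 'rV[R]_3) : R :=
  v x 0 i * v x 0 j + (i == j)%:R * p x.

Lemma momentum_flux_C1 (R : realType) (v : 'rV[R]_3 -> 'rV[R]_3)
    (p : 'rV[R]_3 -> R) i j : test_vector_field v -> test_function p ->
  of_class_C 1 (momentum_flux v p i j).
Proof.
move=> hv hp; apply: class_C1D; apply: class_C1M; try exact: test_function_C1.
exact: class_C1_cst.
Qed.

Lemma momentum_flux_support (R : realType) (v : 'rV[R]_3 -> 'rV[R]_3)
    (p : 'rV[R]_3 -> R) : test_vector_field v -> test_function p ->
  exists2 K, compact K & forall i j x, ~ K x -> momentum_flux v p i j x = 0.
Proof.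
move=> hv [_ hp].
pose K := closure [set x | p x != 0] `|` (closure [set x | v x 0 0 != 0] `|`
  (closure [set x | v x 0 1 != 0] `|` closure [set x | v x 0 2 != 0])).
exists K; first by do !apply: compactU => //; apply (hv _).2.
have K0 (f : 'rV[R]_3 -> R) x : ~ closure [set x | f x != 0] x -> f x = 0.
  by move=> h; apply: contrapT => /eqP fx; apply: h; exact: subset_closure.
move=> i j x /not_orP[/K0 px /not_orP[/(K0 (fun x => v x 0 0)) v0
  /not_orP[/(K0 (fun x => v x 0 1)) v1 /(K0 (fun x => v x 0 2)) v2]]].
have vi k : v x 0 k = 0.
  by have /= := sum3E (fun l => (l == k)%:R * v x 0 l); rewrite v0 v1 v2 !mulr0 !addr0
    (bigD1 k)//= eqxx mul1r big1 ?addr0// => l /negbTE ->; rewrite mul0r.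
by rewrite /momentum_flux vi px mul0r mulr0 addr0.
Qed.

Lemma momentum_flux_divergence (R : realType) (v : 'rV[R]_3 -> 'rV[R]_3)
    (p : 'rV[R]_3 -> R) i x : test_vector_field v -> test_function p ->
  \sum_j partial j (momentum_flux v p i j) x =
  \sum_j partial j (fun y => v y 0 i * v y 0 j) x + partial i p x.
Proof.
move=> hv hp.
have C j : of_class_C 1 (fun y => v y 0 i * v y 0 j).
  by apply: class_C1M; exact: test_function_C1.
have [_ dp _] := test_function_C1 hp.
transitivity (\sum_j (partial j (fun y => v y 0 i * v y 0 j) x +
    (i == j)%:R * partial j p x)).
  apply: eq_bigr => j _; have [_ dC _] := C j.
  have /@derive_val <- // := is_deriveD (derivableP (dC j x))
     (is_derive_scalef (i == j)%:R (derivableP (dp j x))).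
rewrite big_split /=; congr (_ + _).
rewrite (bigD1 i)//= eqxx mul1r big1 ?addr0// => j.
by rewrite eq_sym => /negbTE ->; rewrite mul0r.
Qed.

Theorem proposition5p1 (R : realType) (v : 'rV[R]_3 -> 'rV[R]_3)
    (p : 'rV[R]_3 -> R)
    (hv : test_vector_field v) (hp : test_function p)
    (heuler : forall (i : 'I_3) (x : 'rV[R]_3),
      \sum_(j < 3) partial j (fun y => v y 0 i * v y 0 j) x + partial i p x = 0)
    (L : set 'rV[R]_3) (hL : affine_plane L) :
  is_plane_radon (euler_tensor v p) L 0.
Proof.
split; first exact: affine_plane_frame.
move=> a E [hE _] q.
have [P [PP P0 P1]] := orthonormal_completion hE.
have [|||intF intF0] := @frame_flux_plane0 R (momentum_flux v p) _ _ _ a P PP.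
- by move=> i j; exact: momentum_flux_C1.
- by move=> i x; rewrite momentum_flux_divergence.
- exact: momentum_flux_support.
pose F st := frame_flux (momentum_flux v p) P 2 (frame_point a P (st, 0)).
have qE st : (q st)%:E = (2%:E * (F st)%:E)%E.
  rewrite /q /euler_tensor (restricted_trace_euler _ _ PP P0 P1) -EFinM; congr (2 * _)%:E.
  rewrite /F /frame_flux /frame_point /plane_param /= scale0r addr0 P0 P1.
  apply: eq_bigr => i _; apply: eq_bigr => j _.
  by rewrite /momentum_flux (mulrC (p _)).
have qE' : EFin \o q = (fun st => 2%:E * (F st)%:E)%E by apply/funext => st; exact: qE.
split.
  rewrite qE'; exact: integrableZl.
have intZ := integralZl measurableT intF 2; rewrite intF0 mule0 in intZ.
by rewrite -[LHS]/(fine (\int[planar_measure R]_st (EFin \o q) st)) qE' intZ.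
Qed.
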